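(* The oscillator group $G_\lambda$ carries a complete affine manifold structure, defined on left-invariant vector fields of $G_\lambda$ by the bilinear product $r$ on $\mathfrak{g}_\lambda$ given, for all $x,y$ in the derived ideal $[\mathfrak{g}_\lambda,\mathfrak{g}_\lambda]$, by $$r(x,y)=\tfrac12[x,y],\qquad r(e_{-1},y)=[e_{-1},y],\qquad r(x,e_{-1})=r(e_{-1},e_{-1})=0.$$ That is, the left-invariant affine connection $\nabla$ on $G_\lambda$ with $\nabla_{x}y=r(x,y)$ for left-invariant vector fields $x,y$ has zero curvature and zero torsion and is geodesically complete.
   Context: Let $n\ge 1$ and $\lambda=(\lambda_1,\ldots,\lambda_n)\in\mathbb{R}^n$ with $0<\lambda_1\le\cdots\le\lambda_n$. The oscillator group $G_\lambda$ is the simply connected Lie group with underlying manifold $\mathbb{R}\times\mathbb{R}\times\mathbb{C}^n$ and product $$(t,s,z_1,\ldots,z_n)\cdot(t',s',z'_1,\ldots,z'_n)=\Big(t+t',\,s+s'+\tfrac12\sum_{j=1}^n\mathrm{Im}(\bar z_j e^{it\lambda_j}z'_j),\,\ldots,z_j+e^{it\lambda_j}z'_j,\ldots\Big).$$ Its Lie algebra $\mathfrak{g}_\lambda$ has basis $e_{-1},e_0,e_1,\ldots,e_n,\check e_1,\ldots,\check e_n$ with brackets $[e_{-1},e_j]=\lambda_j\check e_j$, $[e_j,\check e_j]=e_0$, $[e_{-1},\check e_j]=-\lambda_j e_j$, the other brackets being zero or deduced by antisymmetry. The derived ideal is spanned by $e_0,e_1,\ldots,e_n,\check e_1,\ldots,\check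 e_n$, so that together with $e_{-1}$ it spans $\mathfrak{g}_\lambda$. Elements of $\mathfrak{g}_\lambda$ are identified with left-invariant vector fields on $G_\lambda$. An affine manifold structure is identified with a flat torsion-free affine connection; it is complete if its geodesics are defined on all of $\mathbb{R}$. *)

(* Defs.v *)
From HB Require Import structures.
From mathcomp Require Import all_boot all_order all_algebra.
From mathcomp Require Import complex ring.
From mathcomp Require Import all_classical all_reals all_analysis.

Set Implicit Arguments.
Unset Strict Implicit.
Unset Printing Implicit Defensive.
Import Order.TTheory GRing.Theory Num.Theory.
Import numFieldNormedType.Exports.

Local Open Scope classical_set_scope.
Local Open Scope ring_scope.

(* The oscillator group is diffeomorphic to R^(2n+2), so its points, its tangent
  vectors and hence its vector fields (maps V -> V) are described in one global
  linear chart V.  Everything below is meant for V finite dimensional. *)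

(* In finite dimension, f is C^(k+1) iff it is differentiable and all its
   directional derivatives are C^k. *)
Fixpoint Ck (R : realType) (V W : normedModType R) (k : nat) (f : V -> W)
    : Prop :=
  if k is k'.+1 then
    (forall p, differentiable f p) /\ (forall v, Ck k' (fun p => 'd f p v))
  else continuous f.

Definition smooth (R : realType) (V W : normedModType R) (f : V -> W) : Prop :=
  forall k, Ck k f.

Definition lie_bracket (R : realType) (V : normedModType R) (X Y : V -> V)
    : V -> V :=
  fun p => 'd Y p (X p) - 'd X p (Y p).

(* Koszul's axioms; nabla X Y is the covariant derivative of Y along X, and its
   values on fields that are not smooth are irrelevant. *)
Record affine_connection (R : realType) (V : normedModType R)
    (nabla : (V -> V) -> (V -> V) -> (V -> V)) : Prop := AffineConnection {
  conn_smooth : forall X Y, smooth X -> smooth Y -> smooth (nabla X Y);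
  conn_addl : forall X X' Y, smooth X -> smooth X' -> smooth Y ->
    forall p, nabla (fun q => X q + X' q) Y p = nabla X Y p + nabla X' Y p;
  conn_scalel : forall (f : V -> R) X Y, smooth f -> smooth X -> smooth Y ->
    forall p, nabla (fun q => f q *: X q) Y p = f p *: nabla X Y p;
  conn_addr : forall X Y Y', smooth X -> smooth Y -> smooth Y' ->
    forall p, nabla X (fun q => Y q + Y' q) p = nabla X Y p + nabla X Y' p;
  conn_leibniz : forall (f : V -> R) X Y, smooth f -> smooth X -> smooth Y ->
    forall p, nabla X (fun q => f q *: Y q) p
              = f p *: nabla X Y p + 'd f p (X p) *: Y p }.

Definition torsion (R : realType) (V : normedModType R)
    (nabla : (V -> V) -> (V -> V) -> (V -> V)) (X Y : V -> V) : V -> V :=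
  fun p => nabla X Y p - nabla Y X p - lie_bracket X Y p.

Definition curvature (R : realType) (V : normedModType R)
    (nabla : (V -> V) -> (V -> V) -> (V -> V)) (X Y Z : V -> V) : V -> V :=
  fun p => nabla X (nabla Y Z) p - nabla Y (nabla X Z) p
           - nabla (lie_bracket X Y) Z p.

Definition torsion_free (R : realType) (V : normedModType R)
    (nabla : (V -> V) -> (V -> V) -> (V -> V)) : Prop :=
  forall X Y, smooth X -> smooth Y -> forall p, torsion nabla X Y p = 0.

Definition flat (R : realType) (V : normedModType R)
    (nabla : (V -> V) -> (V -> V) -> (V -> V)) : Prop :=
  forall X Y Z, smooth X -> smooth Y -> smooth Z ->
    forall p, curvature nabla X Y Z p = 0.

(* Gamma_p(u, v): the covariant derivative at p of the constant (coordinate)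
   field v along the constant field u. *)
Definition christoffel (R : realType) (V : normedModType R)
    (nabla : (V -> V) -> (V -> V) -> (V -> V)) (p u v : V) : V :=
  nabla (fun=> u) (fun=> v) p.

(* The geodesic equation c'' + Gamma_c(c', c') = 0 on the parameter set I,
   which is always an open interval in what follows. *)
Definition geodesic_on (R : realType) (V : normedModType R)
    (nabla : (V -> V) -> (V -> V) -> (V -> V)) (I : set R) (c : R -> V)
    : Prop :=
  forall t, I t ->
    [/\ derivable c t 1, derivable (derive1 c) t 1 &
        derive1 (derive1 c) t
        + christoffel nabla (c t) (derive1 c t) (derive1 c t) = 0].

(* Every geodesic is the restriction of one defined on all of R. *)
Definition geodesically_complete (R : realType) (V : normedModType R)
    (nabla : (V -> V) -> (V -> V) -> (V -> V)) : Prop :=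
  forall (I : set R) (c : R -> V),
    I !=set0 -> open I -> is_interval I -> geodesic_on nabla I c ->
    exists2 c' : R -> V, geodesic_on nabla setT c' &
      forall t, I t -> c' t = c t.

(* (t, s, (a, b)) stands for the point (t, s, z) of R x R x C^n with
   z_j = a_j + i b_j. The same space serves as the Lie algebra, i.e. as the
   tangent space at the neutral element (0, 0, 0). *)
Definition osc (R : realType) (n : nat) : normedModType R :=
  (R * R * ('rV[R]_n * 'rV[R]_n))%type.

Section OscillatorGroup.
Variables (R : realType) (n : nat).
Implicit Types g h x y : osc R n.

Definition tco g : R := g.1.1.
Definition sco g : R := g.1.2.
Definition zco g (j : 'I_n) : R[i] := Complex (g.2.1 0 j) (g.2.2 0 j).

Definition mk_osc (t s : R) (z : 'I_n -> R[i]) : osc R n :=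
  (t, s, (\row_j complex.Re (z j), \row_j complex.Im (z j))).

Definition expi (a : R) : R[i] := Complex (cos a) (sin a).

Definition osc_mul (lam : 'I_n -> R) g h : osc R n :=
  mk_osc (tco g + tco h)
    (sco g + sco h
     + 2^-1 * \sum_(j < n)
         complex.Im (conjc (zco g j) * expi (tco g * lam j) * zco h j))
    (fun j => zco g j + expi (tco g * lam j) * zco h j).

Definition osc_one : osc R n := mk_osc 0 0 (fun=> 0).

(* The differential of the left translation by g sends the field X to X'. *)
Definition left_related (lam : 'I_n -> R) g (X X' : osc R n -> osc R n)
    : Prop :=
  forall p, 'd (osc_mul lam g) p (X p) = X' (osc_mul lam g p).

Definition left_invariant_connection (lam : 'I_n -> R)
    (nabla : (osc R n -> osc R n) -> (osc R n -> osc R n)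
             -> (osc R n -> osc R n)) : Prop :=
  forall g X X' Y Y', smooth X -> smooth X' -> smooth Y -> smooth Y' ->
    left_related lam g X X' -> left_related lam g Y Y' ->
    left_related lam g (nabla X Y) (nabla X' Y').

(* The left-invariant vector field with value x at the neutral element; this is
   how Lie algebra elements are identified with left-invariant fields. *)
Definition left_field (lam : 'I_n -> R) x : osc R n -> osc R n :=
  fun p => 'd (osc_mul lam p) osc_one x.

(* e_m1 is e_{-1}; e_ j and ec_ j are e_j and \check e_j. *)
Definition e_m1 : osc R n := mk_osc 1 0 (fun=> 0).
Definition e_0 : osc R n := mk_osc 0 1 (fun=> 0).
Definition e_ (j : 'I_n) : osc R n := mk_osc 0 0 (fun k => (k == j)%:R).
Definition ec_ (j : 'I_n) : osc R n :=
  mk_osc 0 0 (fun k => Complex 0 (k == j)%:R).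

(* The bilinear extension of the brackets of the basis vectors, see
   osc_bracket_bilinear, osc_bracketC and the osc_bracket_* lemmas. *)
Definition osc_bracket (lam : 'I_n -> R) x y : osc R n :=
  (0, \sum_(j < n) (x.2.1 0 j * y.2.2 0 j - x.2.2 0 j * y.2.1 0 j),
   (\row_j - (lam j * (tco x * y.2.2 0 j - tco y * x.2.2 0 j)),
    \row_j (lam j * (tco x * y.2.1 0 j - tco y * x.2.1 0 j)))).

Definition derived_ideal (lam : 'I_n -> R) : set (osc R n) :=
  [set x | exists (m : nat) (c : 'I_m -> R) (a b : 'I_m -> osc R n),
     x = \sum_(i < m) c i *: osc_bracket lam (a i) (b i)].

Definition bilinear_product (r : osc R n -> osc R n -> osc R n) : Prop :=
  (forall x, linear (r x)) /\ (forall y, linear (r^~ y)).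

(* These conditions determine r, see osc_product_exists and
   osc_product_unique. *)
Record osc_product (lam : 'I_n -> R) (r : osc R n -> osc R n -> osc R n)
    : Prop := OscProduct {
  osc_product_bilinear : bilinear_product r;
  osc_product_derived : forall x y,
    derived_ideal lam x -> derived_ideal lam y ->
    r x y = 2^-1 *: osc_bracket lam x y;
  osc_product_m1l : forall y,
    derived_ideal lam y -> r e_m1 y = osc_bracket lam e_m1 y;
  osc_product_m1r : forall x, derived_ideal lam x -> r x e_m1 = 0;
  osc_product_m1m1 : r e_m1 e_m1 = 0 }.

End OscillatorGroup.

Section OscillatorLemmas.
Variables (R : realType) (n : nat) (lam : 'I_n -> R).
Implicit Types x y z : osc R n.

Lemma oscP x y : tco x = tco y -> sco x = sco y ->
  (forall j, x.2.1 0 j = y.2.1 0 j) -> (forall j, x.2.2 0 j = y.2.2 0 j) ->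
  x = y.
Proof.
case: x y => -[t s] [a b] [[t' s'] [a' b']]; rewrite /tco /sco /=.
move=> -> -> eqa eqb; congr (_, _, (_, _)); apply/rowP => j //.
Qed.

Lemma osc_bracketC x y : osc_bracket lam x y = - osc_bracket lam y x.
Proof.
apply: oscP; rewrite /tco /sco /=.
- by rewrite oppr0.
- by rewrite -sumrN; apply: eq_bigr => j _; ring.
- by move=> j; rewrite !mxE; ring.
- by move=> j; rewrite !mxE; ring.
Qed.

Lemma osc_bracket_bilinear : bilinear_product (osc_bracket lam).
Proof.
have lin x : linear (osc_bracket lam x).
  move=> c y z; have tE : tco (c *: y + z) = c * tco y + tco z by [].
  apply: oscP => [|||].
  - by rewrite /tco /= scaler0 addr0.
  - rewrite /sco /= -[c *: (\sum_(j < n) _)]/(c * _) mulr_sumr -big_split; apply: eq_bigr => j _ /=.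
    by rewrite /= !mxE; ring.
  - by move=> j; rewrite /= !mxE tE; ring.
  - by move=> j; rewrite /= !mxE tE; ring.
split=> // y c x z; rewrite !(osc_bracketC _ y) lin.
by rewrite opprD scalerN.
Qed.

Lemma osc_bracket_m1_e j :
  osc_bracket lam (e_m1 R n) (e_ R j) = lam j *: ec_ R j.
Proof.
apply: oscP; rewrite /tco /sco /=.
- by rewrite scaler0.
- by rewrite scaler0 big1 // => k _; rewrite !mxE /=; case: eqP => _ /=; ring.
- by move=> k; rewrite !mxE /tco /=; case: eqP => _ /=; ring.
- by move=> k; rewrite !mxE /tco /=; case: eqP => [->|_] /=; ring.
Qed.

Lemma osc_bracket_m1_ec j :
  osc_bracket lam (e_m1 R n) (ec_ R j) = - lam j *: e_ R j.
Proof.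
apply: oscP; rewrite /tco /sco /=.
- by rewrite scaler0.
- by rewrite scaler0 big1 // => k _; rewrite !mxE /=; case: eqP => _ /=; ring.
- by move=> k; rewrite !mxE /tco /=; case: eqP => [->|_] /=; ring.
- by move=> k; rewrite !mxE /tco /=; case: eqP => _ /=; ring.
Qed.

Lemma osc_bracket_e_ec i j :
  osc_bracket lam (e_ R i) (ec_ R j) = (i == j)%:R *: e_0 R n.
Proof.
apply: oscP; rewrite /tco /sco /=.
- by rewrite scaler0.
- rewrite /GRing.scale /= mulr1 (bigD1 i) //= big1 => [|k /negPf ki].
    by rewrite !mxE /= eqxx; case: eqP => _ /=; ring.
  by rewrite !mxE /= ki /=; case: eqP => _ /=; ring.
- by move=> k; rewrite !mxE /tco /=; ring.
- by move=> k; rewrite !mxE /tco /=; case: eqP => _ /=; ring.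
Qed.

Lemma osc_bracket_e_e i j : osc_bracket lam (e_ R i) (e_ R j) = 0.
Proof.
apply: oscP; rewrite /tco /sco //=.
- rewrite big1 // => k _; rewrite !mxE /=.
  by case: eqP => _; case: eqP => _ /=; ring.
- by move=> k; rewrite !mxE /tco /=; ring.
- by move=> k; rewrite !mxE /tco /=; ring.
Qed.

Lemma osc_bracket_ec_ec i j : osc_bracket lam (ec_ R i) (ec_ R j) = 0.
Proof.
apply: oscP; rewrite /tco /sco //=.
- by rewrite big1 // => k _; rewrite !mxE /=; ring.
- by move=> k; rewrite !mxE /tco /=; ring.
- by move=> k; rewrite !mxE /tco /=; ring.
Qed.

Lemma osc_bracket_e_0 x : osc_bracket lam x (e_0 R n) = 0.
Proof.
apply: oscP; rewrite /tco /sco //=.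
- by rewrite big1 // => k _; rewrite !mxE /=; ring.
- by move=> k; rewrite !mxE /tco /=; ring.
- by move=> k; rewrite !mxE /tco /=; ring.
Qed.

Lemma derived_ideal_tco x : derived_ideal lam x -> tco x = 0.
Proof.
move=> [m [c [a [b ->]]]]; rewrite (big_morph (@tco R n) (id1 := 0) (op1 := +%R)) //.
by rewrite big1 // => i _; rewrite /tco /= scaler0.
Qed.

Lemma derived_idealP x : (0 < n)%N -> (forall j, lam j != 0) ->
  derived_ideal lam x <-> tco x = 0.
Proof.
move=> n0 lam0; split=> [|x0]; first exact: derived_ideal_tco.
pose j0 := Ordinal n0.
pose y := mk_osc 0 0
  (fun j => Complex (x.2.2 0 j / lam j) (- (x.2.1 0 j / lam j))).
exists 2%N, (fun i => if i == 0 then sco x else 1),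
  (fun i => if i == 0 then e_ R j0 else e_m1 R n),
  (fun i => if i == 0 then ec_ R j0 else y).
rewrite big_ord_recl big_ord1 /= osc_bracket_e_ec eqxx !scale1r.
apply: oscP; rewrite ?x0 /tco /sco //=.
- by rewrite scaler0 addr0.
- rewrite big1 ?addr0 => [|k _]; first by rewrite /GRing.scale /= mulr1.
  by rewrite !mxE /=; ring.
- move=> j; rewrite !mxE /tco /=.
  by have := lam0 j => lamj; field.
- move=> j; rewrite !mxE /tco /=.
  by have := lam0 j => lamj; field.
Qed.

Lemma osc_product_exists : exists r, osc_product lam r.
Proof.
have [linr linl] := osc_bracket_bilinear.
have scal (a b c : R) x y z t :
    a *: (c *: x + y) + b *: (c *: z + t)
    = c *: (a *: x + b *: z) + (a *: y + b *: t).
  by rewrite !scalerDr !scalerA [c * a]mulrC [c * b]mulrC addrACA.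
pose d x := x - tco x *: e_m1 R n.
have dL : linear d.
  move=> c x y; rewrite /d /tco /= scalerDl scalerBr scalerA opprD.
  by rewrite addrACA.
have dE x : derived_ideal lam x -> d x = x.
  by move=> /derived_ideal_tco x0; rewrite /d x0 scale0r subr0.
have dm : d (e_m1 R n) = 0 by rewrite /d /tco /= scale1r subrr.
have b0 x : osc_bracket lam x 0 = 0.
  by have := linr x (-1) 0 0; rewrite scaler0 addr0 scaleN1r addNr.
have b0l x : osc_bracket lam 0 x = 0 by rewrite osc_bracketC b0 oppr0.
exists (fun x y => 2^-1 *: osc_bracket lam (d x) (d y)
  + tco x *: osc_bracket lam (e_m1 R n) (d y)); split.
- split=> [x c y z|y c x z]; first by rewrite dL !linr scal.
  have -> : tco (c *: x + z) = c * tco x + tco z by [].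
  by rewrite dL linl !scalerDr scalerDl !scalerA [c * 2^-1]mulrC addrACA.
- by move=> x y dx dy; rewrite !dE // derived_ideal_tco // scale0r addr0.
- by move=> y dy; rewrite dm dE // b0l scaler0 add0r /tco /= scale1r.
- by move=> x dx; rewrite dm !b0 !scaler0 addr0.
- by rewrite dm !b0 !scaler0 addr0.
Qed.

Lemma osc_product_unique r r' : (0 < n)%N -> (forall j, lam j != 0) ->
  osc_product lam r -> osc_product lam r' -> r = r'.
Proof.
move=> n0 lam0 [[linr linl] rd rm rx rmm] [[linr' linl'] rd' rm' rx' rmm'].
have dec x : exists2 y, derived_ideal lam y & x = tco x *: e_m1 R n + y.
  exists (x - tco x *: e_m1 R n); last by rewrite addrC subrK.
  apply/derived_idealP => //.
  by rewrite /tco /= /GRing.scale /= mulr1 subrr.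
apply/funext => x; apply/funext => y.
have [x' dx ->] := dec x; have [y' dy ->] := dec y.
rewrite (linl _ (tco x)) (linl' _ (tco x)) !linr !linr'.
by rewrite rmm rmm' rm // rm' // rx // rx' // rd // rd'.
Qed.

End OscillatorLemmas.

(* Main.v *)
Require Import Defs.
From HB Require Import structures.
From mathcomp Require Import all_boot all_order all_algebra.
From mathcomp Require Import ring lra.
From mathcomp Require Import all_classical all_reals all_analysis.
Import Order.TTheory GRing.Theory Num.Theory.
Import numFieldNormedType.Exports.
Local Open Scope classical_set_scope.
Local Open Scope ring_scope.

Set Implicit Arguments.
Unset Strict Implicit.
Unset Printing Implicit Defensive.

(* For fixed g, the left translation h |-> g h is an affine map of the chart
   R x R x C^n; hence the flat connection D_X Y = dY(X) of the chart is
   left-invariant.  Differentiating left-invariant fields gives D_x y = r(x, y),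
   so it is the wanted connection.  Conversely, a connection is determined by
   its values on a global smooth frame, here that of the left-invariant fields,
   so every nabla as in the statement is D on smooth fields.  D is torsion-free
   by definition, its curvature vanishes by the symmetry of second derivatives,
   and its geodesics are the affine lines, which extend to all of R. *)

(** * Differential calculus *)

Section DifferentialCalculus.
Variable R : realType.
Implicit Types V W U : normedModType R.

Lemma linearfun_differentiable V W (f : V -> W) :
  linear f -> continuous f -> forall p, differentiable f p.
Proof.
move=> fL fC p; pose F : {linear V -> W} := HB.pack f (GRing.isLinear.Build _ _ _ _ f fL).
exact: (@linear_differentiable _ _ _ F).
Qed.

Lemma diff_linearfun V W (f : V -> W) :
  linear f -> continuous f -> forall p, 'd f p = f :> (V -> W).
Proof.
move=> fL fC p; pose F : {linear V -> W} := HB.pack f (GRing.isLinear.Build _ _ _ _ f fL).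
exact: (@diff_lin _ _ _ F).
Qed.

Lemma diff_valE V W (f df : V -> W) p v : is_diff p f df -> 'd f p v = df v.
Proof. by move=> [_ ->]. Qed.

Lemma scale_is_bilinear W :
  bilinear_for
    (GRing.Scale.Law.clone _ _ *:%R _) (GRing.Scale.Law.clone _ _ *:%R _)
    (fun (a : R) (w : W) => a *: w).
Proof.
split=> [w|a] b x y /=; first by rewrite scalerDl scalerA.
by rewrite scalerDr !scalerA mulrC.
Qed.

(** Scaling is a continuous bilinear map, so the product rule is its differential composed with that
    of the pair [(f, g)]. *)
Lemma is_diff_scale V W (f : V -> R) (g : V -> W) p :
  differentiable f p -> differentiable g p ->
  is_diff p (fun q => f q *: g q) (fun v => f p *: 'd g p v + 'd f p v *: g p).
Proof.
move=> df dg.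
pose B : {bilinear R -> W -> W} := HB.pack (fun (a : R) (w : W) => a *: w)
  (bilinear_isBilinear.Build R R W W _ _ _ (scale_is_bilinear W)).
have cB : continuous (fun q : R * W => B q.1 q.2).
  by move=> q; apply: scale_continuous.
have dB q := differentiable_bilin q cB.
have dpr := differentiable_pair df dg.
have -> : (fun q => f q *: g q) = (fun q : R * W => B q.1 q.2) \o (fun q => (f q, g q)) by [].
apply: DiffDef; first exact: differentiable_comp.
by rewrite diff_comp// diff_bilin// diff_pair.
Qed.

(** * Stability of C^k and smooth maps under sums, products, linear maps, sine and cosine *)

Lemma CkW V W k (f : V -> W) : Ck k.+1 f -> Ck k f.
Proof.
elim: k f => [f [df _] p|k IH f [df Hf]]; first exact/differentiable_continuous.
by split=> // v; apply: IH.
Qed.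

Lemma Ck_cst V W k (w : W) : Ck k (fun _ : V => w).
Proof.
elim: k w => [w|k IH w]; first exact: cst_continuous.
split=> [p|v]; first exact: differentiable_cst.
have -> : (fun p => 'd (fun _ : V => w) p v) = (fun=> 0) by apply/funext => p; rewrite diff_cst.
exact: IH.
Qed.

Lemma CkD V W k (f g : V -> W) : Ck k f -> Ck k g -> Ck k (fun q => f q + g q).
Proof.
elim: k f g => [f g cf cg p|k IH f g [df Hf] [dg Hg]]; first by apply: cvgD; [exact: cf|exact: cg].
split=> [p|v]; first exact: differentiableD.
have -> : (fun p => 'd (fun q => f q + g q) p v) = (fun p => 'd f p v + 'd g p v).
  by apply/funext => p; rewrite (@diffD _ _ _ f g).
exact: (IH _ _ (Hf v) (Hg v)).
Qed.

(** Induction on [k] by the product rule. The derivative contains [f] and [g] themselves besides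
    their derivatives, and [CkW] lowers their order to that of the induction hypothesis. *)
Lemma CkZ V W k (f : V -> R) (g : V -> W) :
  Ck k f -> Ck k g -> Ck k (fun q => f q *: g q).
Proof.
elim: k f g => [f g cf cg p|k IH f g Cf Cg].
  by apply: cvgZ; [exact: cf|exact: cg].
have [df Hf] := Cf; have [dg Hg] := Cg.
have H p := is_diff_scale (df p) (dg p).
split=> [p|v]; first by case: (H p).
have -> : (fun p => 'd (fun q => f q *: g q) p v) = (fun p => f p *: 'd g p v + 'd f p v *: g p).
  by apply/funext => p; rewrite diff_val.
by apply: CkD; apply: IH; [exact: CkW|exact: Hg|exact: Hf|exact: CkW].
Qed.

Lemma Ck_linear_comp V W U k (l : W -> U) (f : V -> W) :
  linear l -> continuous l -> Ck k f -> Ck k (fun q => l (f q)).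
Proof.
move=> lL lC; elim: k f => [f cf p|k IH f [df Hf]].
  by apply: (@continuous_comp _ _ _ f l); [exact: cf|exact: lC].
split=> [p|v]; first by apply: (@differentiable_comp _ _ _ _ f l) => //; apply: linearfun_differentiable.
have -> : (fun p => 'd (fun q => l (f q)) p v) = (fun p => l ('d f p v)).
  apply/funext => p; rewrite (@diff_comp _ _ _ _ f l)//=; last exact: linearfun_differentiable.
  by rewrite diff_linearfun.
exact: (IH _ (Hf v)).
Qed.

Lemma Ck_linear V W k (f : V -> W) : linear f -> continuous f -> Ck k f.
Proof.
move=> fL fC; case: k => [//|k]; split=> [p|v]; first exact: linearfun_differentiable.
have -> : (fun p => 'd f p v) = (fun=> f v) by apply/funext => p; rewrite diff_linearfun.
exact: Ck_cst.
Qed.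

Lemma is_diff_sin_cos V (l : V -> R) p : differentiable l p ->
  is_diff p (fun q => sin (l q)) (fun v => cos (l p) * 'd l p v) /\
  is_diff p (fun q => cos (l q)) (fun v => - sin (l p) * 'd l p v).
Proof.
move=> dl.
have ds x : differentiable (@sin R) x by apply/derivable1_diffP.
have dc x : differentiable (@cos R) x by apply/derivable1_diffP.
split; apply: DiffDef.
- exact: (@differentiable_comp _ _ _ _ l).
- rewrite (@diff_comp _ _ _ _ l)// diff1E//; apply/funext => v /=.
  by rewrite derive1E derive_val mulrC.
- exact: (@differentiable_comp _ _ _ _ l).
- rewrite (@diff_comp _ _ _ _ l)// diff1E//; apply/funext => v /=.
  by rewrite derive1E derive_val mulrC.
Qed.

(** Sine and cosine go through one induction because each occurs in the derivative of the other. *)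
Lemma Ck_sin_cos V k (l : V -> R) : Ck k l ->
  Ck k (fun q => sin (l q)) /\ Ck k (fun q => cos (l q)).
Proof.
elim: k => [cl|k IH Cl].
  split=> p.
    by apply: (@continuous_comp _ _ _ l (@sin R)); [exact: cl|exact: continuous_sin].
  by apply: (@continuous_comp _ _ _ l (@cos R)); [exact: cl|exact: continuous_cos].
have [dl Hl] := Cl; have [Cs Cc] := IH (CkW Cl).
split.
- split=> [p|v]; first by have [[]] := is_diff_sin_cos (dl p).
  have -> : (fun p => 'd (fun q => sin (l q)) p v) = (fun p => cos (l p) *: 'd l p v).
    by apply/funext => p; have [H _] := is_diff_sin_cos (dl p); rewrite diff_val.
  exact: (CkZ Cc (Hl v)).
- split=> [p|v]; first by have [_ []] := is_diff_sin_cos (dl p).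
  have -> : (fun p => 'd (fun q => cos (l q)) p v) = (fun p => sin (l p) *: ((-1) *: 'd l p v)).
    apply/funext => p; have [_ H] := is_diff_sin_cos (dl p); rewrite diff_val scaleN1r scalerN.
    by rewrite mulNr.
  apply: CkZ; first exact: Cs.
  apply: CkZ; [exact: Ck_cst|exact: Hl].
Qed.

Lemma smooth_cst V W (w : W) : smooth (fun _ : V => w).
Proof. by move=> k; exact: Ck_cst. Qed.

Lemma smoothD V W (f g : V -> W) :
  smooth f -> smooth g -> smooth (fun q => f q + g q).
Proof. by move=> Sf Sg k; apply: CkD. Qed.

Lemma smoothZ V W (f : V -> R) (g : V -> W) :
  smooth f -> smooth g -> smooth (fun q => f q *: g q).
Proof. by move=> Sf Sg k; apply: CkZ. Qed.

Lemma smoothM V (f g : V -> R) :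
  smooth f -> smooth g -> smooth (fun q => f q * g q).
Proof. exact: smoothZ. Qed.

Lemma smoothN V (f : V -> R) : smooth f -> smooth (fun q => - f q).
Proof.
move=> Sf; have -> : (fun q => - f q) = (fun q => (-1) *: f q).
  by apply/funext => q; rewrite scaleN1r.
by apply: smoothZ => //; exact: smooth_cst.
Qed.

Lemma smoothB V (f g : V -> R) :
  smooth f -> smooth g -> smooth (fun q => f q - g q).
Proof. by move=> Sf Sg; apply: smoothD => //; exact: smoothN. Qed.

Lemma smooth_sum V W (I : Type) (s : seq I) (f : I -> V -> W) :
  (forall i, smooth (f i)) -> smooth (fun q => \sum_(i <- s) f i q).
Proof.
move=> Sf; elim: s => [|i s IH].
  have -> : (fun q => \sum_(i <- [::]) f i q) = (fun=> 0).
    by apply/funext => q; rewrite big_nil.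
  exact: smooth_cst.
have -> : (fun q => \sum_(j <- i :: s) f j q) = (fun q => f i q + \sum_(j <- s) f j q).
  by apply/funext => q; rewrite big_cons.
exact: smoothD.
Qed.

Lemma smooth_linear_comp V W U (l : W -> U) (f : V -> W) :
  linear l -> continuous l -> smooth f -> smooth (fun q => l (f q)).
Proof. by move=> lL lC Sf k; exact: Ck_linear_comp. Qed.

Lemma smooth_linear V W (f : V -> W) : linear f -> continuous f -> smooth f.
Proof. by move=> fL fC k; exact: Ck_linear. Qed.

Lemma smooth_sin V (l : V -> R) : smooth l -> smooth (fun q => sin (l q)).
Proof. by move=> Sl k; have [] := Ck_sin_cos (Sl k). Qed.

Lemma smooth_cos V (l : V -> R) : smooth l -> smooth (fun q => cos (l q)).
Proof. by move=> Sl k; have [] := Ck_sin_cos (Sl k). Qed.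

Lemma smooth_differentiable V W (f : V -> W) :
  smooth f -> forall p, differentiable f p.
Proof. by move=> /(_ 1%N)[]. Qed.

Lemma smooth_diff V W (f : V -> W) v : smooth f -> smooth (fun p => 'd f p v).
Proof. by move=> Sf k; have [_ H] := Sf k.+1; exact: H. Qed.

Lemma diff_linear_comp V W U (l : W -> U) (f : V -> W) p v :
  linear l -> continuous l -> differentiable f p ->
  'd (fun q => l (f q)) p v = l ('d f p v).
Proof.
move=> lL lC df; rewrite (@diff_comp _ _ _ _ f l)//=; last exact: linearfun_differentiable.
by rewrite diff_linearfun.
Qed.

(** The chain rule along an affine line, which reduces questions on [V] to one-variable calculus. *)
Lemma differentiable_line V W (f : V -> W) (p v : V) (s : R) :
  differentiable f (p + s *: v) ->
  is_derive s 1 (fun t => f (p + t *: v)) ('d f (p + s *: v) v).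
Proof.
move=> df.
have dl : is_diff s (fun t : R => p + t *: v) (fun t => t *: v).
  by apply: is_diff_eq; rewrite add0r.
have dc : differentiable (fun t : R => f (p + t *: v)) s.
  apply: (@differentiable_comp _ _ _ _ (fun t : R => p + t *: v) f); [exact: ex_diff|exact: df].
apply: DeriveDef; first exact/derivable1_diffP.
rewrite deriveE// (@diff_comp _ _ _ _ (fun t : R => p + t *: v) f)//= diff_val.
by rewrite scale1r.
Qed.

End DifferentialCalculus.

(** * Symmetry of second derivatives *)

Section SecondDerivative.
Variable R : realType.
Implicit Types V W U : normedModType R.

Lemma MVT_is_derive (f df : R -> R) (a b : R) :
  a < b -> (forall x, is_derive x (1 : R) f (df x)) ->
  exists2 c, a <= c <= b & f b - f a = df c * (b - a).
Proof.
move=> ab Hf; have cf : {within `[a, b], continuous f}%classic.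
  apply: continuous_subspaceT => x.
  exact/differentiable_continuous/derivable1_diffP.
have [c cab E] := @MVT R f df a b ab (fun x _ => Hf x) cf.
by exists c => //; move: cab; rewrite in_itv /= => /andP[/ltW -> /ltW ->].
Qed.

(** Two applications of the mean value theorem: first in direction [u] to the increment of [f] along
    [h *: v], then in direction [v] to the resulting derivative along [u]. *)
Lemma second_difference V (f : V -> R) (p u v : V) (h : R) :
  Ck 2 f -> 0 < h ->
  exists s t, [/\ 0 <= s <= h, 0 <= t <= h &
    f (p + h *: v + h *: u) - f (p + h *: u) - (f (p + h *: v) - f p)
    = 'd (fun q => 'd f q u) (p + s *: u + t *: v) v * (h * h)].
Proof.
move=> [df Hf] h0.
pose phi s := f (p + h *: v + s *: u) - f (p + s *: u).
pose dphi s := 'd f (p + h *: v + s *: u) u - 'd f (p + s *: u) u.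
have Hphi s : is_derive s (1 : R) phi (dphi s).
  by apply: is_deriveB; apply: differentiable_line.
have [s /= hs Es] := MVT_is_derive h0 Hphi.
have [dfu _] := Hf u.
pose psi t := 'd f (p + s *: u + t *: v) u.
have Hpsi t : is_derive t (1 : R) psi ('d (fun q => 'd f q u) (p + s *: u + t *: v) v).
  exact: (differentiable_line (f := fun q => 'd f q u)).
have [t /= ht Et] := MVT_is_derive h0 Hpsi.
exists s, t; split => //.
move: Es Et; rewrite /phi /psi /dphi !scale0r !addr0 !subr0 => Es Et.
by rewrite mulrA -Et Es [p + s *: u + _]addrAC.
Qed.

(** Continuity at the origin of [F] composed with the plane (s, t) |-> p + s u + t v. One radius
    serves both parameters because balls of [R * R] are products of balls. *)
Lemma continuous_near_corner V (F : V -> R) (p u v : V) (e : R) :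
  {for p, continuous F} -> 0 < e ->
  exists2 d, 0 < d & forall s t, `|s| < d -> `|t| < d ->
    `|F (p + s *: u + t *: v) - F p| < e.
Proof.
move=> cF e0.
have : (fun z : R * R => F (p + z.1 *: u + z.2 *: v)) @ ((0, 0) : R * R) --> F p.
  have -> : F p = F (p + (0 : R) *: u + (0 : R) *: v) by rewrite !scale0r !addr0.
  apply: (@cvg_comp _ _ _ (fun z : R * R => p + z.1 *: u + z.2 *: v) F _
    (nbhs (p + (0 : R) *: u + (0 : R) *: v))); last first.
    by rewrite !scale0r !addr0; exact: cF.
  apply: cvgD; first (apply: cvgD; first exact: cvg_cst).
    by apply: cvgZr_tmp; exact: cvg_fst.
  by apply: cvgZr_tmp; exact: cvg_snd.
move=> /cvgrPdist_lt /(_ _ e0) /nbhs_ballP[d /= d0 Hd].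
exists d => // s t hs ht; rewrite distrC; apply: (Hd (s, t)).
by split; rewrite -ball_normE /ball_ /= sub0r normrN.
Qed.

(* Both mixed derivatives, at suitable nearby points, equal the same second
   difference quotient. *)
Lemma mixed_diff_sym V (f : V -> R) (p u v : V) : Ck 2 f ->
  'd (fun q => 'd f q u) p v = 'd (fun q => 'd f q v) p u.
Proof.
move=> Cf; have [_ Hf] := Cf.
have [_ /(_ v) cF] := Hf u; have [_ /(_ u) cG] := Hf v.
set F := fun q => 'd (fun q => 'd f q u) q v in cF *.
set G := fun q => 'd (fun q => 'd f q v) q u in cG *.
rewrite -/(F p) -/(G p).
have [//|ne] := eqVneq (F p) (G p); exfalso.
pose e := `|F p - G p|; have e0 : 0 < e by rewrite normr_gt0 subr_eq0.
have e2 : 0 < e / 2 by rewrite divr_gt0.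
have [d d0 Hd] := continuous_near_corner u v (cF p) e2.
have [d' d'0 Hd'] := continuous_near_corner v u (cG p) e2.
(* Half the minimum, so that parameters up to and including [h] stay strictly below both radii. *)
pose h := Num.min d d' / 2.
have m0 : 0 < Num.min d d' by rewrite lt_min d0.
have h0 : 0 < h by rewrite divr_gt0.
have hm : h < Num.min d d' by rewrite /h; lra.
have [hd hd'] : h < d /\ h < d' by move: hm; rewrite lt_min => /andP[].
have small s k : 0 <= s <= h -> h < k -> `|s| < k.
  by move=> /andP[s0 sh] hk; rewrite ger0_norm// (le_lt_trans sh).
have [s [t [hs ht E]]] := second_difference p u v Cf h0.
have [t' [s' [ht' hs' E']]] := second_difference p v u Cf h0.
have FG : F (p + s *: u + t *: v) = G (p + t' *: v + s' *: u).
  apply: (@mulIf _ (h * h)); first by rewrite mulf_neq0 ?gt_eqF.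
  by rewrite -E -E' [p + h *: v + _]addrAC; ring.
have := Hd s t (small _ _ hs hd) (small _ _ ht hd).
have := Hd' t' s' (small _ _ ht' hd') (small _ _ hs' hd').
rewrite -FG => A B.
(* [F p] and [G p] lie within [e / 2] of the same number, so their distance [e] would be smaller
   than itself. *)
suff : e < e by rewrite ltxx.
have eE : F p - G p = (F (p + s *: u + t *: v) - G p) - (F (p + s *: u + t *: v) - F p) by ring.
by rewrite {1}/e eE (le_lt_trans (ler_normB _ _))// [ltRHS]splitr ltrD.
Qed.

End SecondDerivative.

(** * Coordinates on the chart *)

Section Coordinates.
Variables (R : realType) (n : nat).
Implicit Types (V W U : normedModType R).

(** The 2 + 2n real coordinates as one finite type: [inl] covers t and s, [inr] the real parts
    ([true]) and imaginary parts ([false]) of the z_j. Sums over a basis are then single sums. *)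
Definition osc_index : finType := (bool + bool * 'I_n)%type.

Definition osc_coord (k : osc_index) (p : osc R n) : R :=
  match k with
  | inl true => tco p
  | inl false => sco p
  | inr (true, j) => p.2.1 0 j
  | inr (false, j) => p.2.2 0 j
  end.

Definition osc_basis (k : osc_index) : osc R n :=
  match k with
  | inl true => e_m1 R n
  | inl false => e_0 R n
  | inr (true, j) => e_ R j
  | inr (false, j) => ec_ R j
  end.

Lemma osc_coord_inj (p q : osc R n) : (forall k, osc_coord k p = osc_coord k q) -> p = q.
Proof.
move=> H; apply: oscP => [||j|j].
- exact: (H (inl true)).
- exact: (H (inl false)).
- exact: (H (inr (true, j))).
- exact: (H (inr (false, j))).
Qed.

Lemma osc_coord_linear k : linear (osc_coord k).
Proof. by case: k => [[]|[[] j]] c p q //=; rewrite !mxE. Qed.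

Lemma osc_coord_continuous k : continuous (osc_coord k).
Proof.
have c1 (A B : normedModType R) : continuous (fst : A * B -> A) by move=> x; exact: cvg_fst.
have c2 (A B : normedModType R) : continuous (snd : A * B -> B) by move=> x; exact: cvg_snd.
have cf1 := c1 (R * R)%type ('rV[R]_n * 'rV[R]_n)%type.
have cf2 := c2 (R * R)%type ('rV[R]_n * 'rV[R]_n)%type.
case: k => [[]|[[] j]] p /=.
- exact: (continuous_comp (cf1 p) (c1 R R _)).
- exact: (continuous_comp (cf1 p) (c2 R R _)).
- apply: (@continuous_comp _ _ _ snd (fun y : 'rV[R]_n * 'rV[R]_n => y.1 0 j)); first exact: cf2.
  apply: (@continuous_comp _ _ _ fst (fun M : 'rV[R]_n => M 0 j)); first exact: c1.
  exact: coord_continuous.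
- apply: (@continuous_comp _ _ _ snd (fun y : 'rV[R]_n * 'rV[R]_n => y.2 0 j)); first exact: cf2.
  apply: (@continuous_comp _ _ _ snd (fun M : 'rV[R]_n => M 0 j)); first exact: c2.
  exact: coord_continuous.
Qed.

Lemma osc_coord_basis k l : osc_coord k (osc_basis l) = (k == l)%:R.
Proof.
case: k => [[]|[[] i]]; case: l => [[]|[[] j]] //=; rewrite ?mxE //=.
  have -> : (inr (true, i) == inr (true, j) :> osc_index) = (i == j) by [].
  by case: (i == j).
by case: (i == j).
Qed.

Lemma linearfun_sum V W (f : V -> W) (I : Type) (s : seq I) (c : I -> R) (v : I -> V) :
  linear f -> f (\sum_(i <- s) c i *: v i) = \sum_(i <- s) c i *: f (v i).
Proof.
move=> fL; pose F : {linear V -> W} := HB.pack f (GRing.isLinear.Build _ _ _ _ f fL).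
rewrite -[LHS]/(F _) linear_sum; apply: eq_bigr => i _; exact: linearZZ.
Qed.

Lemma osc_expand (p : osc R n) : p = \sum_k osc_coord k p *: osc_basis k.
Proof.
apply: osc_coord_inj => k; rewrite (linearfun_sum _ _ _ (osc_coord_linear k)).
rewrite (bigD1 k)//= big1 ?addr0 => [|l /negPf lk].
  by rewrite osc_coord_basis eqxx; exact: esym (mulr1 _).
by rewrite osc_coord_basis eq_sym lk scaler0.
Qed.

Lemma linear_expand W (f : osc R n -> W) v :
  linear f -> f v = \sum_k osc_coord k v *: f (osc_basis k).
Proof. by move=> fL; rewrite {1}[v]osc_expand linearfun_sum. Qed.

(** Finite dimension enters here: in coordinates a linear map is a finite sum of smooth functions
    times constant vectors. *)
Lemma osc_linear_smooth W (f : osc R n -> W) : linear f -> smooth f.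
Proof.
move=> fL.
have -> : f = fun v => \sum_k osc_coord k v *: f (osc_basis k).
  by apply/funext => v; exact: linear_expand.
apply: smooth_sum => k; apply: smoothZ; last exact: smooth_cst.
by apply: smooth_linear; [exact: osc_coord_linear|exact: osc_coord_continuous].
Qed.

Lemma osc_linear_continuous W (f : osc R n -> W) : linear f -> continuous f.
Proof. by move=> /osc_linear_smooth /(_ 0%N). Qed.

Lemma smooth_osc_coord V (F : V -> osc R n) k :
  smooth F -> smooth (fun q => osc_coord k (F q)).
Proof.
by apply: smooth_linear_comp; [exact: osc_coord_linear|exact: osc_coord_continuous].
Qed.

Lemma smooth_oscP V (F : V -> osc R n) :
  (forall k, smooth (fun q => osc_coord k (F q))) -> smooth F.
Proof.
move=> SF; have -> : F = fun q => \sum_k osc_coord k (F q) *: osc_basis k.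
  by apply/funext => q; exact: osc_expand.
by apply: smooth_sum => k; apply: smoothZ => //; exact: smooth_cst.
Qed.

Lemma diff_osc_coord V (F : V -> osc R n) k p v : differentiable F p ->
  osc_coord k ('d F p v) = 'd (fun q => osc_coord k (F q)) p v.
Proof.
move=> dF; rewrite (@diff_linear_comp _ _ _ _ (osc_coord k) F)//.
  exact: osc_coord_linear.
exact: osc_coord_continuous.
Qed.

Lemma diff_isLinear V W (F : V -> W) p : linear ('d F p).
Proof. by move=> c u v; rewrite linearP. Qed.

Lemma diff_expand W (F : osc R n -> W) p v :
  'd F p v = \sum_k osc_coord k v *: 'd F p (osc_basis k).
Proof. exact/linear_expand/diff_isLinear. Qed.

(** Smoothness of [Z] only controls derivatives along fixed vectors. Expanding [X q] in the constant
    basis reduces the varying direction to these. *)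
Lemma smooth_diff_along W (X : osc R n -> osc R n) (Z : osc R n -> W) :
  smooth X -> smooth Z -> smooth (fun q => 'd Z q (X q)).
Proof.
move=> SX SZ.
have -> : (fun q => 'd Z q (X q)) =
    (fun q => \sum_k osc_coord k (X q) *: 'd Z q (osc_basis k)).
  by apply/funext => q; exact: diff_expand.
apply: smooth_sum => k; apply: smoothZ; last exact: smooth_diff.
exact: smooth_osc_coord.
Qed.

(** The scalar case [mixed_diff_sym] applied to each coordinate of [Z]. *)
Lemma smooth_mixed_diff_sym V (Z : V -> osc R n) p u v : smooth Z ->
  'd (fun q => 'd Z q u) p v = 'd (fun q => 'd Z q v) p u.
Proof.
move=> SZ; apply: osc_coord_inj => k.
have E u' v' : osc_coord k ('d (fun q => 'd Z q u') p v')
    = 'd (fun q => 'd (fun q => osc_coord k (Z q)) q u') p v'.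
  rewrite diff_osc_coord; last exact/smooth_differentiable/smooth_diff.
  refine (congr1 (fun g : V -> R => 'd g p v') _); apply/funext => q.
  by rewrite diff_osc_coord//; exact: smooth_differentiable.
rewrite (E u v) (E v u); apply: mixed_diff_sym.
exact: (smooth_osc_coord k SZ 2%N).
Qed.

Lemma is_diff_big_sum V W (I : Type) (s : seq I) (F : I -> V -> W) p :
  (forall i, differentiable (F i) p) ->
  is_diff p (fun q => \sum_(i <- s) F i q) (fun v => \sum_(i <- s) 'd (F i) p v).
Proof.
move=> dF; elim: s => [|i s IH].
  have -> : (fun q => \sum_(i <- [::]) F i q) = cst 0 by apply/funext => q; rewrite big_nil.
  by apply: (is_diff_eq (is_diff_cst _ _)); apply/funext => v; rewrite big_nil.
have -> : (fun q => \sum_(j <- i :: s) F j q) = F i + (fun q => \sum_(j <- s) F j q).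
  by apply/funext => q; rewrite big_cons.
have di := differentiableP (dF i).
by apply: (is_diff_eq (is_diffD di IH)); apply/funext => v; rewrite big_cons.
Qed.

(** The product rule is applied termwise to dZ(Y) expanded in the basis. Symmetry of second
    derivatives then exchanges [w] with each basis vector, so that the second-order terms regroup
    into one differential along [Y p]. *)
Lemma second_diff_along (Y Z : osc R n -> osc R n) p w : smooth Y -> smooth Z ->
  'd (fun q => 'd Z q (Y q)) p w = 'd Z p ('d Y p w) + 'd (fun q => 'd Z q w) p (Y p).
Proof.
move=> SY SZ.
have -> : (fun q => 'd Z q (Y q)) =
    (fun q => \sum_k osc_coord k (Y q) *: 'd Z q (osc_basis k)).
  by apply/funext => q; exact: diff_expand.
have dY k : differentiable (fun q => osc_coord k (Y q)) p.
  exact/smooth_differentiable/smooth_osc_coord.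
have dZ k : differentiable (fun q => 'd Z q (osc_basis k)) p.
  exact/smooth_differentiable/smooth_diff.
have dYZ k := is_diff_scale (dY k) (dZ k).
have dS := is_diff_big_sum (index_enum osc_index) (fun k => @ex_diff _ _ _ _ _ _ _ (dYZ k)).
refine (etrans (diff_valE w dS) _).
refine (etrans _ (esym (congr2 +%R (diff_expand Z p ('d Y p w)) (diff_expand (fun q => 'd Z q w) p (Y p))))).
rewrite -big_split.
apply: eq_bigr => k _ /=.
refine (etrans (diff_valE w (dYZ k)) _).
refine (etrans (addrC _ _) _).
have eY := diff_osc_coord k w (smooth_differentiable SY p).
have eZ := smooth_mixed_diff_sym p w (osc_basis k) SZ.
refine (congr2 +%R (congr1 ( *:%R^~ _) (esym eY)) (congr1 ( *:%R _) (esym eZ))).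
Qed.

End Coordinates.

(** * Left-invariant fields *)

Section LeftFields.
Variables (R : realType) (n : nat) (lam : 'I_n -> R).
Implicit Types (g h p x y v : osc R n).

(** [rot_re] and [rot_im] are the real and imaginary parts of e^{i t lam_j} y_j, where t is the time
    coordinate of [p]. *)
Definition rot_re y (j : 'I_n) p : R :=
  cos (tco p * lam j) * y.2.1 0 j - sin (tco p * lam j) * y.2.2 0 j.

Definition rot_im y (j : 'I_n) p : R :=
  sin (tco p * lam j) * y.2.1 0 j + cos (tco p * lam j) * y.2.2 0 j.

(** This map plays two roles: it is the linear part of the left translation by [p] ([osc_mulE]), and
    its value at [y] is the left-invariant field [y] at [p] ([left_fieldE]). *)
Definition osc_frame p y : osc R n :=
  (tco y,
   sco y + 2^-1 * \sum_(j < n) (p.2.1 0 j * rot_im y j p - p.2.2 0 j * rot_re y j p),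
   (\row_j rot_re y j p, \row_j rot_im y j p)).

(** The components of [v] in the left-invariant frame at [p]: the rotation is undone, and the
    correction of the central coordinate is subtracted. That correction depends on the rotated
    components, which are those of [v] itself. *)
Definition osc_coframe p v : osc R n :=
  (tco v,
   sco v - 2^-1 * \sum_(j < n) (p.2.1 0 j * v.2.2 0 j - p.2.2 0 j * v.2.1 0 j),
   (\row_j (cos (tco p * lam j) * v.2.1 0 j + sin (tco p * lam j) * v.2.2 0 j),
    \row_j (cos (tco p * lam j) * v.2.2 0 j - sin (tco p * lam j) * v.2.1 0 j))).

(** Im(conj(z) w) = Re(z) Im(w) - Im(z) Re(w), so for fixed [g] the product depends on [h] through a
    linear map and a constant. *)
Lemma osc_mulE g h : osc_mul lam g h = g + osc_frame g h.
Proof.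
apply: oscP; rewrite /tco /sco /=.
- by [].
- rewrite addrA; congr (_ + _ * _); apply: eq_bigr => j _.
  by rewrite /rot_im /rot_re /tco /=; ring.
- by move=> j; rewrite !mxE /rot_re /tco /=; ring.
- by move=> j; rewrite !mxE /rot_im /tco /=; ring.
Qed.

Lemma osc_frame_linear g : linear (osc_frame g).
Proof.
move=> c x y; apply: oscP.
- by [].
- pose S z := \sum_(j < n) (g.2.1 0 j * rot_im z j g - g.2.2 0 j * rot_re z j g).
  have SL : S (c *: x + y) = c * S x + S y.
    rewrite /S mulr_sumr -big_split; apply: eq_bigr => j _.
    by rewrite /rot_im /rot_re /= !mxE; ring.
  rewrite -[LHS]/(c * sco x + sco y + 2^-1 * S (c *: x + y)) SL.
  rewrite -[RHS]/(c * (sco x + 2^-1 * S x) + (sco y + 2^-1 * S y)); ring.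
- by move=> j; rewrite /= !mxE /rot_re /= !mxE; ring.
- by move=> j; rewrite /= !mxE /rot_im /= !mxE; ring.
Qed.

Lemma is_diff_osc_mul g p : is_diff p (osc_mul lam g) (osc_frame g).
Proof.
have fL := osc_frame_linear g; have fC := osc_linear_continuous fL.
have -> : osc_mul lam g = cst g + osc_frame g.
  by apply/funext => h; rewrite osc_mulE.
have df : is_diff p (osc_frame g) (osc_frame g).
  by apply: DiffDef; [exact: linearfun_differentiable|exact: diff_linearfun].
by apply: (is_diff_eq (is_diffD (is_diff_cst g p) df)); rewrite add0r.
Qed.

Lemma left_fieldE x p : left_field lam x p = osc_frame p x.
Proof. by rewrite /left_field (@diff_val _ _ _ _ _ _ _ (is_diff_osc_mul p _)). Qed.

Lemma osc_coframeK p v : osc_frame p (osc_coframe p v) = v.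
Proof.
(* The right-hand side is multiplied by 1 = cos^2 + sin^2, which turns the claim into a polynomial
   identity. *)
have re j : rot_re (osc_coframe p v) j p = v.2.1 0 j.
  by rewrite /rot_re /= !mxE -[RHS]mul1r -(cos2Dsin2 (tco p * lam j)); ring.
have im j : rot_im (osc_coframe p v) j p = v.2.2 0 j.
  by rewrite /rot_im /= !mxE -[RHS]mul1r -(cos2Dsin2 (tco p * lam j)); ring.
apply: oscP; rewrite /tco /sco /=.
- by [].
- rewrite -[RHS]addr0 -addrA; congr (_ + _); apply/eqP; rewrite addrC subr_eq0; apply/eqP.
  by congr (_ * _); apply: eq_bigr => j _; rewrite re im.
- by move=> j; rewrite mxE re.
- by move=> j; rewrite mxE im.
Qed.

Lemma tco_linear : linear (@tco R n). Proof. exact: (osc_coord_linear (inl true)). Qed.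

Lemma smooth_angle j : smooth (fun p => tco p * lam j).
Proof.
by apply: smoothM; [exact: (osc_linear_smooth tco_linear)|exact: smooth_cst].
Qed.

Lemma smooth_coord k : smooth (@osc_coord R n k).
Proof. exact/osc_linear_smooth/osc_coord_linear. Qed.

Lemma smooth_rot_re y j : smooth (rot_re y j).
Proof.
apply: smoothB; apply: smoothM; try exact: smooth_cst.
- exact: (smooth_cos (smooth_angle j)).
- exact: (smooth_sin (smooth_angle j)).
Qed.

Lemma smooth_rot_im y j : smooth (rot_im y j).
Proof.
apply: smoothD; apply: smoothM; try exact: smooth_cst.
- exact: (smooth_sin (smooth_angle j)).
- exact: (smooth_cos (smooth_angle j)).
Qed.

Lemma smooth_left_field x : smooth (left_field lam x).
Proof.
have -> : left_field lam x = osc_frame^~ x by apply/funext => p; exact: left_fieldE.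
apply: smooth_oscP => -[[]|[[] j]] /=.
- exact: smooth_cst.
- apply: smoothD; first exact: smooth_cst.
  apply: smoothM; first exact: smooth_cst.
  apply: smooth_sum => j; apply: smoothB; apply: smoothM.
  + exact: (smooth_coord (inr (true, j))).
  + exact: smooth_rot_im.
  + exact: (smooth_coord (inr (false, j))).
  + exact: smooth_rot_re.
- by under eq_fun do rewrite mxE; exact: smooth_rot_re.
- by under eq_fun do rewrite mxE; exact: smooth_rot_im.
Qed.

Lemma smooth_coframe (Y : osc R n -> osc R n) :
  smooth Y -> smooth (fun p => osc_coframe p (Y p)).
Proof.
move=> SY; apply: smooth_oscP => -[[]|[[] j]] /=.
- exact: (smooth_osc_coord (inl true) SY).
- apply: smoothB; first exact: (smooth_osc_coord (inl false) SY).
  apply: smoothM; first exact: smooth_cst.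
  apply: smooth_sum => j; apply: smoothB; apply: smoothM.
  + exact: (smooth_coord (inr (true, j))).
  + exact: (smooth_osc_coord (inr (false, j)) SY).
  + exact: (smooth_coord (inr (false, j))).
  + exact: (smooth_osc_coord (inr (true, j)) SY).
- under eq_fun do rewrite mxE; apply: smoothD; apply: smoothM.
  + exact: (smooth_cos (smooth_angle j)).
  + exact: (smooth_osc_coord (inr (true, j)) SY).
  + exact: (smooth_sin (smooth_angle j)).
  + exact: (smooth_osc_coord (inr (false, j)) SY).
- under eq_fun do rewrite mxE; apply: smoothB; apply: smoothM.
  + exact: (smooth_cos (smooth_angle j)).
  + exact: (smooth_osc_coord (inr (false, j)) SY).
  + exact: (smooth_sin (smooth_angle j)).
  + exact: (smooth_osc_coord (inr (true, j)) SY).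
Qed.

Lemma is_diff_coord k p : is_diff p (@osc_coord R n k) (@osc_coord R n k).
Proof.
have kL := @osc_coord_linear R n k; have kC := @osc_coord_continuous R n k.
by apply: DiffDef; [exact: linearfun_differentiable|exact: diff_linearfun].
Qed.

(** Only the time coordinate varies, and differentiating e^{i t lam_j} y_j multiplies it by i lam_j,
    which exchanges real and imaginary parts up to sign. *)
Lemma is_diff_rot y j p :
  is_diff p (rot_re y j) (fun v => - (tco v * lam j * rot_im y j p)) /\
  is_diff p (rot_im y j) (fun v => tco v * lam j * rot_re y j p).
Proof.
have dt := is_diff_coord (inl true) p.
have dl : is_diff p (fun q => tco q * lam j) (fun v => tco v * lam j).
  rewrite (_ : (fun q : osc R n => tco q * lam j) = @osc_coord R n (inl true) * cst (lam j))//.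
  apply: is_diff_eq; apply/funext => v.
  rewrite !fctE /GRing.scale /= mulr0 add0r.
  by rewrite mulrC.
have [ds dc] := is_diff_sin_cos (@ex_diff _ _ _ _ _ _ _ dl).
rewrite diff_val in ds dc.
split.
- apply: (is_diff_eq (is_diffB (is_diffM dc (is_diff_cst (y.2.1 0 j) p))
    (is_diffM ds (is_diff_cst (y.2.2 0 j) p)))).
  apply/funext => v; rewrite !fctE /GRing.scale /=.
  by rewrite (_ : (0 : osc R n -> R) v = 0)// /rot_im; ring.
- apply: (is_diff_eq (is_diffD (is_diffM ds (is_diff_cst (y.2.1 0 j) p))
    (is_diffM dc (is_diff_cst (y.2.2 0 j) p)))).
  apply/funext => v; rewrite !fctE /GRing.scale /=.
  by rewrite (_ : (0 : osc R n -> R) v = 0)// /rot_re; ring.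
Qed.

(** The product [r] in coordinates: the central component carries the factor 1/2 of the bracket on
    the derived ideal, and the other components come from the action of [e_m1] on the left. *)
Definition osc_left_prod x y : osc R n :=
  (0, 2^-1 * \sum_(j < n) (x.2.1 0 j * y.2.2 0 j - x.2.2 0 j * y.2.1 0 j),
   (\row_j - (lam j * (tco x * y.2.2 0 j)), \row_j (lam j * (tco x * y.2.1 0 j)))).

(** The computation behind the formula for [r]. Differentiating the rotations of y_j gives the terms
    in [tco x]. Differentiating the coefficients a_j, b_j in the central coordinate gives half of
    Im(conj(x_j) y_j), both factors being rotated by the same angle. *)
Lemma diff_left_field x y p :
  'd (left_field lam y) p (left_field lam x p) = left_field lam (osc_left_prod x y) p.
Proof.
have SL := smooth_left_field y.
apply: osc_coord_inj => k; rewrite diff_osc_coord; last exact: smooth_differentiable.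
have E : (fun q => osc_coord k (left_field lam y q)) = (fun q => osc_coord k (osc_frame q y)).
  by apply/funext => q; rewrite left_fieldE.
rewrite E !left_fieldE => {E}.
have dre j := (is_diff_rot y j p).1; have dim j := (is_diff_rot y j p).2.
case: k => [[]|[[] j]] /=.
- by rewrite (@diff_cst R (osc R n) R).
- have dj j : is_diff p
    (fun q : osc R n => q.2.1 0 j * rot_im y j q - q.2.2 0 j * rot_re y j q)
    (fun v => p.2.1 0 j * (tco v * lam j * rot_re y j p) + v.2.1 0 j * rot_im y j p
      + p.2.2 0 j * (tco v * lam j * rot_im y j p) - v.2.2 0 j * rot_re y j p).
    have da := is_diff_coord (inr (true, j)) p.
    have db := is_diff_coord (inr (false, j)) p.
    rewrite (_ : (fun q => _) = @osc_coord R n (inr (true, j)) * rot_im y j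
       - @osc_coord R n (inr (false, j)) * rot_re y j)//.
    apply: (is_diff_eq (is_diffB (is_diffM da (dim j)) (is_diffM db (dre j)))).
    by apply/funext => v; rewrite !fctE /GRing.scale /=; ring.
  have ds := is_diff_big_sum (index_enum 'I_n) (fun j => @ex_diff _ _ _ _ _ _ _ (dj j)).
  pose Sg (q : osc R n) := \sum_(j < n) (q.2.1 0 j * rot_im y j q - q.2.2 0 j * rot_re y j q).
  rewrite -/(Sg) in ds.
  rewrite (_ : (fun q => _) = cst (sco y) + 2^-1 \*: Sg)//.
  rewrite diff_val fctE /= add0r /GRing.scale /=.
  rewrite -[RHS]/(2^-1 * (\sum_(j < n) (x.2.1 0 j * y.2.2 0 j - x.2.2 0 j * y.2.1 0 j))
    + 2^-1 * \sum_(j < n) (p.2.1 0 j * rot_im (osc_left_prod x y) j p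
                           - p.2.2 0 j * rot_re (osc_left_prod x y) j p)).
  rewrite -mulrDr -big_split; congr (_ * _); apply: eq_bigr => j _ /=.
  rewrite diff_val /= !mxE.
  (* The z_j-component of the product is [tco x * lam j] times i y_j, and multiplication by i
     commutes with rotation. *)
  have -> : rot_re (osc_left_prod x y) j p = - (tco x * lam j * rot_im y j p).
    by rewrite /rot_re /rot_im /= !mxE; ring.
  have -> : rot_im (osc_left_prod x y) j p = tco x * lam j * rot_re y j p.
    by rewrite /rot_re /rot_im /= !mxE; ring.
  (* A common rotation preserves the area form Im(conj(x_j) y_j). *)
  have -> : x.2.1 0 j * y.2.2 0 j - x.2.2 0 j * y.2.1 0 j
     = rot_re x j p * rot_im y j p - rot_im x j p * rot_re y j p.
    by rewrite -[LHS]mul1r -(cos2Dsin2 (tco p * lam j)) /rot_re /rot_im; ring.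
  rewrite -[tco (osc_frame p x)]/(tco x); ring.
- have -> : (fun q => (\row_j rot_re y j q) 0 j) = rot_re y j by apply/funext => q; rewrite mxE.
  rewrite diff_val mxE -[tco (osc_frame p x)]/(tco x) /rot_re /rot_im /= !mxE; ring.
- have -> : (fun q => (\row_j rot_im y j q) 0 j) = rot_im y j by apply/funext => q; rewrite mxE.
  rewrite diff_val mxE -[tco (osc_frame p x)]/(tco x) /rot_re /rot_im /= !mxE; ring.
Qed.

(** On the derived ideal [tco] vanishes, which removes the terms in [lam] and leaves half the
    bracket. With [e_m1] on the left, only the terms in [lam] survive. *)
Lemma osc_left_prodP : osc_product lam osc_left_prod.
Proof.
split.
- split=> [x c y z|y c x z]; apply: oscP => [|||].
  + by rewrite /tco /= scaler0 addr0.
  + pose S (z t : osc R n) := \sum_(j < n) (z.2.1 0 j * t.2.2 0 j - z.2.2 0 j * t.2.1 0 j) : R.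
    have SL : S x (c *: y + z) = c * S x y + S x z.
      by rewrite /S mulr_sumr -big_split; apply: eq_bigr => j _; rewrite /= !mxE; ring.
    rewrite -[LHS]/(2^-1 * S x (c *: y + z)) SL -[RHS]/(c * (2^-1 * S x y) + 2^-1 * S x z); ring.
  + by move=> j; rewrite /= !mxE; ring.
  + by move=> j; rewrite /= !mxE; ring.
  + by rewrite /tco /= scaler0 addr0.
  + pose S (z t : osc R n) := \sum_(j < n) (z.2.1 0 j * t.2.2 0 j - z.2.2 0 j * t.2.1 0 j) : R.
    have SL : S (c *: x + z) y = c * S x y + S z y.
      by rewrite /S mulr_sumr -big_split; apply: eq_bigr => j _; rewrite /= !mxE; ring.
    rewrite -[LHS]/(2^-1 * S (c *: x + z) y) SL -[RHS]/(c * (2^-1 * S x y) + 2^-1 * S z y); ring.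
  + by move=> j; rewrite /= !mxE tco_linear /GRing.scale /=; ring.
  + by move=> j; rewrite /= !mxE tco_linear /GRing.scale /=; ring.
- move=> x y /derived_ideal_tco x0 /derived_ideal_tco y0; apply: oscP => [|||].
  + by rewrite /tco /= scaler0.
  + by [].
  + by move=> j; rewrite /= !mxE x0 y0; ring.
  + by move=> j; rewrite /= !mxE x0 y0; ring.
- move=> y /derived_ideal_tco y0; apply: oscP => [|||].
  + by [].
  + by rewrite /sco /= !big1 ?mulr0 // => j _; rewrite !mxE /=; ring.
  + by move=> j; rewrite /= !mxE y0 /tco /=; ring.
  + by move=> j; rewrite /= !mxE y0 /tco /=; ring.
- move=> x /derived_ideal_tco x0; apply: oscP => [|||].
  + by [].
  + by rewrite /sco /= !big1 ?mulr0 // => j _; rewrite !mxE /=; ring.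
  + by move=> j; rewrite /= !mxE /=; ring.
  + by move=> j; rewrite /= !mxE /=; ring.
- apply: oscP => [|||].
  + by [].
  + by rewrite /sco /= !big1 ?mulr0 // => j _; rewrite !mxE /=; ring.
  + by move=> j; rewrite /= !mxE /=; ring.
  + by move=> j; rewrite /= !mxE /=; ring.
Qed.

End LeftFields.

(** * The flat connection of the chart *)

Definition chart_connection (R : realType) (V : normedModType R)
    (X Y : V -> V) : V -> V := fun p => 'd Y p (X p).

(** * Connections and global frames *)

Section Frames.
Variables (R : realType) (V : normedModType R).
Implicit Types nabla : (V -> V) -> (V -> V) -> (V -> V).

Lemma connection_suml nabla (I : Type) (s : seq I) (f : I -> V -> R) (E : I -> V -> V) Y p :
  affine_connection nabla ->
  (forall i, smooth (f i)) -> (forall i, smooth (E i)) -> smooth Y ->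
  nabla (fun q => \sum_(i <- s) f i q *: E i q) Y p
  = \sum_(i <- s) f i p *: nabla (E i) Y p.
Proof.
move=> nablaP Sf SE SY; elim: s => [|i s IH].
  rewrite big_nil.
  (* Writing the zero field as a zero multiple lets homogeneity over functions give its
     derivative. *)
  have -> : (fun q => \sum_(i <- [::]) f i q *: E i q) = (fun q => (0 : R) *: (0 : V)).
    by apply/funext => q; rewrite big_nil scaler0.
  rewrite (conn_scalel nablaP (f := fun=> 0) (X := fun=> 0))//; try exact: smooth_cst.
  by rewrite scale0r.
have -> : (fun q => \sum_(j <- i :: s) f j q *: E j q)
    = (fun q => f i q *: E i q + \sum_(j <- s) f j q *: E j q).
  by apply/funext => q; rewrite big_cons.
rewrite (conn_addl nablaP (X := fun q => f i q *: E i q))//.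
- by rewrite big_cons IH (conn_scalel nablaP (Sf i) (SE i)).
- exact: smoothZ.
- by apply: smooth_sum => j; exact: smoothZ.
Qed.

Lemma connection_sumr nabla (I : Type) (s : seq I) (f : I -> V -> R) (E : I -> V -> V) X p :
  affine_connection nabla ->
  (forall i, smooth (f i)) -> (forall i, smooth (E i)) -> smooth X ->
  nabla X (fun q => \sum_(i <- s) f i q *: E i q) p
  = \sum_(i <- s) (f i p *: nabla X (E i) p + 'd (f i) p (X p) *: E i p).
Proof.
move=> nablaP Sf SE SX; elim: s => [|i s IH].
  rewrite big_nil.
  (* With both factors zero, each of the two terms of the Leibniz rule vanishes. *)
  have -> : (fun q => \sum_(i <- [::]) f i q *: E i q) = (fun q => (0 : R) *: (0 : V)).
    by apply/funext => q; rewrite big_nil scaler0.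
  rewrite (conn_leibniz nablaP (f := fun=> 0) (Y := fun=> 0))//; try exact: smooth_cst.
  by rewrite scale0r scaler0 addr0.
have -> : (fun q => \sum_(j <- i :: s) f j q *: E j q)
    = (fun q => f i q *: E i q + \sum_(j <- s) f j q *: E j q).
  by apply/funext => q; rewrite big_cons.
rewrite (conn_addr nablaP (Y := fun q => f i q *: E i q))//.
- by rewrite big_cons IH (conn_leibniz nablaP (Sf i) SX (SE i)).
- exact: smoothZ.
- by apply: smooth_sum => j; exact: smoothZ.
Qed.

End Frames.

(** Expanding [Y] in the frame, the Leibniz rule produces derivatives of components, which do not
    involve the connection, and terms in the derivatives of the [E i]. Expanding [X] reduces the
    latter to pairs of frame fields. *)
Lemma connection_eq_frame (R : realType) (V : normedModType R)
    (D D' : (V -> V) -> (V -> V) -> (V -> V)) (I : finType) (E : I -> V -> V)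
    (co : I -> (V -> V) -> V -> R) :
  affine_connection D -> affine_connection D' ->
  (forall i, smooth (E i)) ->
  (forall i X, smooth X -> smooth (co i X)) ->
  (forall X q, X q = \sum_i co i X q *: E i q) ->
  (forall i j p, D (E i) (E j) p = D' (E i) (E j) p) ->
  forall X Y, smooth X -> smooth Y -> forall p, D X Y p = D' X Y p.
Proof.
move=> DP DP' SE Sco EX EE X Y SX SY p.
have XE Z : Z = (fun q => \sum_i co i Z q *: E i q) by apply/funext => q; exact: EX.
rewrite (XE Y) !connection_sumr//; try by move=> i; exact: Sco.
apply: eq_bigr => i _; congr (_ *: _ + _).
rewrite (XE X) !connection_suml//; try by move=> j; exact: Sco.
by apply: eq_bigr => j _; rewrite EE.
Qed.

(** * Axioms, curvature, torsion and geodesics of the chart connection *)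

Section ChartConnection.
Variables (R : realType) (n : nat).
Notation V := (osc R n).

Lemma chart_connectionP : affine_connection (@chart_connection R V).
Proof.
split=> [X Y SX SY|X X' Y _ _ _ p|f X Y _ _ _ p|X Y Y' _ SY SY' p|f X Y Sf _ SY p].
- exact: smooth_diff_along.
- exact: linearD.
- exact: linearZZ.
- have H := diffD (smooth_differentiable SY p) (smooth_differentiable SY' p).
  have H' := congr1 (fun g : V -> V => g (X p)) H.
  exact: H'.
- have H := is_diff_scale (smooth_differentiable Sf p) (smooth_differentiable SY p).
  exact: (diff_valE (X p) H).
Qed.

(** By [second_diff_along], the two iterated derivatives of [Z] share the same second-order term by
    symmetry. Their difference is thus dZ of dY(X) - dX(Y), the bracket. *)
Lemma chart_flat : flat (@chart_connection R V).
Proof.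
move=> X Y Z SX SY SZ p.
have cancel (W : zmodType) (a b c : W) : a + c - (b + c) - (a - b) = 0.
  by rewrite opprD addrACA subrr addr0 subrr.
have E1 := second_diff_along p (X p) SY SZ.
have E2 := second_diff_along p (Y p) SX SZ.
have E3 := smooth_mixed_diff_sym p (Y p) (X p) SZ.
have E4 : 'd Z p (lie_bracket X Y p) = 'd Z p ('d Y p (X p)) - 'd Z p ('d X p (Y p)).
  exact: linearB.
refine (etrans (congr2 (fun a b => a - b) (congr2 (fun a b => a - b) E1
  (etrans E2 (congr1 ( +%R _) E3))) E4) _).
exact: cancel.
Qed.

Lemma chart_torsion_free : torsion_free (@chart_connection R V).
Proof. by move=> X Y _ _ p; rewrite /torsion /lie_bracket /chart_connection subrr. Qed.

(** Agreement on smooth fields suffices because the inner covariant derivatives and the Lie bracket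
    are smooth again. *)
Lemma curvature_ext (D D' : (V -> V) -> (V -> V) -> (V -> V)) X Y Z p :
  affine_connection D' ->
  (forall X Y, smooth X -> smooth Y -> forall p, D X Y p = D' X Y p) ->
  smooth X -> smooth Y -> smooth Z -> curvature D X Y Z p = curvature D' X Y Z p.
Proof.
move=> DP' DE SX SY SZ; rewrite /curvature.
have E A B : smooth A -> smooth B -> D A B = D' A B.
  by move=> SA SB; apply/funext => q; exact: DE.
have SL : smooth (lie_bracket X Y).
  move=> k; apply: CkD; first exact: (smooth_diff_along SX SY).
  rewrite (_ : (fun q => _) = fun q => (-1 : R) *: 'd X q (Y q)).
    by apply: CkZ; [exact: Ck_cst|exact: (smooth_diff_along SY SX)].
  by apply/funext => q; rewrite scaleN1r.
by rewrite !E//; apply: (conn_smooth DP').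
Qed.

Lemma derive0_interval_cst (I : set R) (f : R -> R) a b :
  is_interval I -> (forall t, I t -> is_derive t (1 : R) f 0) ->
  I a -> I b -> f a = f b.
Proof.
move=> II Hf; wlog ab : a b / a <= b.
  by move=> H Ia Ib; have [/H->|/ltW /H->] := leP a b.
move=> Ia Ib.
have sub x : x \in `[a, b]%R -> I x.
  by rewrite in_itv /= => xab; exact: (II a b).
have sub' x : x \in `]a, b[%R -> I x.
  by move=> xab; apply: sub; exact: subset_itv_oo_cc.
have [||c _ E] := @MVT_segment R f (fun=> 0) a b ab.
- by move=> x /sub' /Hf.
- by apply: derivable_within_continuous => x /sub /Hf [].
by apply/esym/eqP; rewrite -subr_eq0 E mul0r.
Qed.

Lemma is_derive_osc_coord (c : R -> V) k t (w : V) :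
  derivable c t 1 -> derive1 c t = w ->
  is_derive t (1 : R) (fun s => osc_coord k (c s)) (osc_coord k w).
Proof.
move=> /derivable1_diffP dc <-.
have kL := @osc_coord_linear R n k; have kC := @osc_coord_continuous R n k.
have dk : differentiable (fun s => osc_coord k (c s)) t.
  by apply: (@differentiable_comp _ _ _ _ c) => //; exact: linearfun_differentiable.
apply: DeriveDef; first exact/derivable1_diffP.
by rewrite deriveE// -diff_osc_coord// derive1E deriveE.
Qed.

(** The equation becomes c'' = 0. Coordinate by coordinate, the mean value theorem makes c' constant
    on [I], and then makes c equal there to a line, which is a geodesic on all of R. *)
Lemma geodesically_complete_chart (D : (V -> V) -> (V -> V) -> (V -> V)) :
  (forall p u v, christoffel D p u v = 0) -> geodesically_complete D.
Proof.
move=> D0 I c [t0 It0] _ II Hc.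
pose v : V := derive1 c t0.
have c1 t : I t -> (derive1 c t : V) = v.
  move=> It; apply: osc_coord_inj => k.
  apply: (derive0_interval_cst (f := fun s => osc_coord k (derive1 c s)) II) It It0.
  move=> s Is; have [_ d2 e2] := Hc s Is; rewrite D0 addr0 in e2.
  have := is_derive_osc_coord k d2 e2.
  by rewrite (_ : osc_coord k 0 = 0)//; case: k => [[]|[[] j]] //=; rewrite mxE.
(* The line with velocity [v], parametrized to meet [c] at time [t0]. *)
pose l (t : R) : V := (c t0 - t0 *: v) + t *: v.
have dl t : is_derive t (1 : R) l v.
  (* The derivative of the line is that of the identity map along it. *)
  have di := is_diff_id (c t0 - t0 *: v + t *: v).
  have H := differentiable_line (@ex_diff _ _ _ _ _ _ _ di).
  exact: (is_derive_eq H (diff_valE v di)).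
have l1 t : (derive1 l t : V) = v by rewrite derive1E derive_val.
have l1E : derive1 l = cst v := funext l1.
exists l.
  move=> t _; split; first by have [] := dl t.
    by rewrite l1E; exact: derivable_cst.
  by rewrite D0 addr0 l1E derive1_cst.
move=> t It; apply: osc_coord_inj => k; apply/eqP; rewrite -subr_eq0; apply/eqP.
have l0 : l t0 = c t0 by rewrite /l subrK.
rewrite -[RHS](subrr (osc_coord k (c t0))) -{1}l0.
apply: (derive0_interval_cst (f := fun s => osc_coord k (l s) - osc_coord k (c s)) II) It It0.
move=> s Is; have [d1 _ _] := Hc s Is.
have [dls _] := dl s.
have A := is_derive_osc_coord k d1 (c1 s Is).
have B := is_derive_osc_coord k dls (l1 s).
exact: (is_derive_eq (is_deriveB B A) (subrr _)).
Qed.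

End ChartConnection.

(** Differentiate the relation dL_g(Y) = Y' o L_g along [X]. Since dL_g is the same linear map at
    every point, the left side gives dL_g(dY(X)); the chain rule and the relation for [X] turn the
    right side into dY'(X') at the translated point. *)
Lemma chart_connection_left_invariant (R : realType) (n : nat) (lam : 'I_n -> R) :
  left_invariant_connection lam (@chart_connection R (osc R n)).
Proof.
move=> g X X' Y Y' _ _ SY SY' RX RY p.
have dm q := is_diff_osc_mul lam g q.
have dmE q v : 'd (osc_mul lam g) q v = osc_frame lam g v.
  exact: (diff_valE v (dm q)).
have fL := osc_frame_linear lam g; have fC := osc_linear_continuous fL.
have E : (fun q => osc_frame lam g (Y q)) = Y' \o osc_mul lam g.
  by apply/funext => q; have := RY q; rewrite dmE.
have E1 := diff_linear_comp (X p) fL fC (smooth_differentiable SY p).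
have E2 := diff_comp (@ex_diff _ _ _ _ _ _ _ (dm p)) (smooth_differentiable SY' (osc_mul lam g p)).
have E3 := congr1 (fun f : osc R n -> osc R n => f (X p)) E2.
have E4 := congr1 (fun F : osc R n -> osc R n => 'd F p (X p)) E.
have E5 := congr1 ('d Y' (osc_mul lam g p)) (RX p).
exact: etrans (dmE p _) (etrans (esym E1) (etrans E4 (etrans E3 E5))).
Qed.

Lemma connection_eq_left_fields (R : realType) (n : nat) (lam : 'I_n -> R)
    (D D' : (osc R n -> osc R n) -> (osc R n -> osc R n) -> (osc R n -> osc R n)) :
  affine_connection D -> affine_connection D' ->
  (forall x y p, D (left_field lam x) (left_field lam y) p
                 = D' (left_field lam x) (left_field lam y) p) ->
  forall X Y, smooth X -> smooth Y -> forall p, D X Y p = D' X Y p.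
Proof.
move=> DP DP' DE.
apply: (connection_eq_frame (E := fun k => left_field lam (osc_basis R k))
  (co := fun k X q => osc_coord k (osc_coframe lam q (X q))) DP DP').
- by move=> k; exact: smooth_left_field.
- by move=> k X SX; apply: smooth_osc_coord; exact: smooth_coframe.
(* By linearity of [osc_frame lam q], the combination of left-invariant fields is the frame map
   applied to the coframe components. *)
- move=> X q; under eq_bigr do rewrite left_fieldE.
  by rewrite -(linear_expand _ (osc_frame_linear lam q)) osc_coframeK.
- by move=> i j p; exact: DE.
Qed.

Theorem mainTheorem2 (R : realType) (n : nat) (lam : 'I_n -> R)
    (r : osc R n -> osc R n -> osc R n) :
  (1 <= n)%N ->
  (forall j, 0 < lam j) ->
  (forall i j : 'I_n, (i <= j)%N -> lam i <= lam j) ->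
  osc_product lam r ->
  (exists nabla,
     [/\ affine_connection nabla, left_invariant_connection lam nabla &
         forall x y p, nabla (left_field lam x) (left_field lam y) p
                       = left_field lam (r x y) p]) /\
  (forall nabla,
     [/\ affine_connection nabla, left_invariant_connection lam nabla &
         forall x y p, nabla (left_field lam x) (left_field lam y) p
                       = left_field lam (r x y) p] ->
     [/\ flat nabla, torsion_free nabla & geodesically_complete nabla]).
Proof.
move=> n0 lam0 _ rP.
have lam_neq0 j : lam j != 0 by rewrite gt_eqF.
(* Nonzero [lam j] make the derived ideal a complement of the line of [e_m1], so the prescribed
   values determine [r]. *)
have rE : r = osc_left_prod lam by exact: osc_product_unique rP (osc_left_prodP lam).
have chartE x y p : chart_connection (left_field lam x) (left_field lam y) p
    = left_field lam (r x y) p by rewrite rE; exact: diff_left_field.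
split.
  exists (@chart_connection R (osc R n)); split=> //.
    exact: chart_connectionP.
  exact: chart_connection_left_invariant.
move=> nabla [nablaP _ nablaE].
have E : forall X Y, smooth X -> smooth Y ->
    forall p, nabla X Y p = chart_connection X Y p.
  refine (@connection_eq_left_fields R n lam nabla _ nablaP (@chart_connectionP R n) _).
  by move=> x y p; rewrite nablaE chartE.
split.
- move=> X Y Z SX SY SZ p.
  by rewrite (curvature_ext _ (@chart_connectionP R n) E)//; exact: chart_flat.
- move=> X Y SX SY p; rewrite /torsion (E X Y)// (E Y X)//.
  exact: chart_torsion_free.
- apply: geodesically_complete_chart => p u v.
  (* Coordinate fields are constant, hence smooth, and the chart connection annihilates them. *)
  rewrite /christoffel E; try exact: smooth_cst.
  exact: (diff_valE u (is_diff_cst v p)).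
Qed.
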